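(* Let $n>1$ and let $X$ be a finite pure $n$-dimensional weighted simplicial complex such that all the links of $X$ of dimension $>0$ (including $X=X_\emptyset$) are connected. Let $f(x) = 2-\frac{1}{x}$ and let $f^j$ be the composition of $f$ with itself $j$ times (where $f^0 (x) = x$). If there are $\kappa \geq \lambda > \frac{n-1}{n}$ such that $$\bigcup_{\tau \in \Sigma (n-2)} \mathrm{Spec} (\Delta_{\tau, 0}^+) \setminus \lbrace 0 \rbrace \subseteq [\lambda, \kappa],$$ then for every $0 \leq k \leq n-1$, $$\left\Vert \Delta_k^+ + c_k \Delta_k^- - (k+1) \left(c_k - \dfrac{k}{k+1}\right) I \right\Vert \leq \dfrac{k+1}{2} \left(f^{n-1-k} (\kappa) - f^{n-1-k} (\lambda)\right),$$ where $c_k=\dfrac{f^{n-1-k}(\lambda)+f^{n-1-k}(\kappa)}{2}$ and $\Vert\cdot\Vert$ denotes the operator norm on $C^k(X,\mathbb R)$.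
   Context: $X$ is pure $n$-dimensional if every simplex is a face of an $n$-simplex. $X^{(k)}$ is the set of $k$-simplices and $\Sigma(k)$ the set of ordered $k$-simplices ($(k+1)$-tuples of vertices forming a $k$-simplex), $-1\le k\le n$, with $X^{(-1)}=\Sigma(-1)=\{\emptyset\}$. Weighted means equipped with a balanced weight function: a function $m:\bigcup_{-1\le k\le n}X^{(k)}\to(0,\infty)$ with $\sum_{\sigma\in X^{(k+1)},\tau\subset\sigma}m(\sigma)=m(\tau)$ for all $-1\le k\le n-1$, $\tau\in X^{(k)}$. It is extended to ordered simplices by forgetting the order. $C^k(X,\mathbb R)$ is the space of antisymmetric functions $\Sigma(k)\to\mathbb R$ with inner product $\langle\phi,\psi\rangle=\sum_{\tau\in\Sigma(k)}\frac{m(\tau)}{(k+1)!}\phi(\tau)\psi(\tau)$. The differential $d_k:C^k\to C^{k+1}$ is $(d_k\phi)((v_0,\dots,v_{k+1}))=\sum_{i}(-1)^i\phi((v_0,\dots,\widehat{v_i},\dots,v_{k+1}))$ for $-1\le k\le n-1$, $\delta_k:C^{k+1}\to C^k$ is its adjoint, and $\Delta_k^+=\delta_kd_k$, $\Delta_k^-=d_{k-1}\delta_{k-1}$ on $C^k(X,\mathbb R)$. For $\tau\in\Sigma(j)$, the link $X_\tau$ is the complex of simplices $\sigma$ disjoint from $\tau$ with $\tau\cup\sigma$ a simplex of $X$; it is pure of dimension $n-j-1$, $X_\emptyset=X$, and it carries the balanced weight $m_\tau(\sigma)=m(\tau\sigma)$ ($\tau\sigma$ the concatenation). $\Delta^{\pm}_{\tau,k}$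 denote the operators $\Delta_k^\pm$ defined for $(X_\tau,m_\tau)$. $\mathrm{Spec}$ denotes the spectrum. *)

(* Defs.v *)
From HB Require Import structures.
(* Loaded first so that set0, setU0 and the like are those of finset. *)
From mathcomp Require Import classical_sets reals.
From mathcomp Require Import all_boot all_order all_fingroup all_algebra.

Set Implicit Arguments.
Unset Strict Implicit.
Unset Printing Implicit Defensive.

Import Order.TTheory GRing.Theory Num.Theory.

Local Open Scope ring_scope.

(* The vertices of a complex are the v with [set v] in it; they need not
   exhaust the ambient type V, so that links live on the same V. *)
Record scomplex (V : finType) := SComplex {
  simplices :> {set {set V}};
  scomplex0 : set0 \in simplices;
  scomplexS : forall s t : {set V}, t \subset s -> s \in simplices ->
                t \in simplices }.

Definition pure_dim (V : finType) (n : nat) (X : scomplex V) : Prop :=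
  forall s : {set V}, s \in simplices X ->
    exists2 t : {set V}, (t \in simplices X) && (#|t| == n.+1) & s \subset t.

Definition balanced_weight (R : realType) (V : finType) (n : nat)
    (X : scomplex V) (m : {set V} -> R) : Prop :=
  (forall s : {set V}, s \in simplices X -> 0 < m s) /\
  (forall t : {set V}, t \in simplices X -> (#|t| <= n)%N ->
     \sum_(s in simplices X | (#|s| == #|t|.+1) && (t \subset s)) m s = m t).

(* Connectedness of the 1-skeleton. *)
Definition connected_complex (V : finType) (X : scomplex V) : Prop :=
  forall u v : V, [set u] \in simplices X -> [set v] \in simplices X ->
    connect [rel x y | [set x; y] \in simplices X] u v.

(* Dimensions are shifted by one so as to start at 0: [osimplex X j] is
   Sigma(j - 1), the ordered simplices with j vertices. *)
Definition osimplex (V : finType) (X : scomplex V) (j : nat) :=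
  {t : j.-tuple V | uniq t && ([set x in t] \in simplices X)}.

HB.instance Definition _ V X j := SubFinite.on (@osimplex V X j).

Section OrderedSimplices.
Variables (V : finType) (X : scomplex V).

Definition vset j (t : osimplex X j) : {set V} := [set x in val t].

Lemma vset_simplex j (t : osimplex X j) : vset t \in simplices X.
Proof. by case/andP: (valP t). Qed.

Fact osimplex_sub_subproof i j (t : osimplex X j) (h : 'I_i -> 'I_j) :
  injective h ->
  let u := [tuple tnth (val t) (h k) | k < i] in
  uniq u && ([set x in u] \in simplices X).
Proof.
move=> h_inj; cbv zeta; case/andP: (valP t) => /tuple_uniqP t_inj tX.
apply/andP; split.
  by apply/tuple_uniqP=> a b; rewrite !tnth_mktuple => /t_inj/h_inj.
apply: scomplexS tX; apply/subsetP => x; rewrite !inE => /tnthP[k ->].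
by rewrite tnth_mktuple mem_tnth.
Qed.

(* (v_{h 0}, ..., v_{h (i-1)}) *)
Definition osimplex_sub i j (t : osimplex X j) (h : 'I_i -> 'I_j)
    (h_inj : injective h) : osimplex X i :=
  Sub [tuple tnth (val t) (h k) | k < i] (osimplex_sub_subproof t h_inj).

Definition face j (i : 'I_j.+1) (t : osimplex X j.+1) : osimplex X j :=
  osimplex_sub t (@lift_inj j.+1 i).

Definition permute j (s : 'S_j) (t : osimplex X j) : osimplex X j :=
  osimplex_sub t (@perm_inj _ s).

Fact link_subproof0 j (t : osimplex X j) :
  set0 \in [set s : {set V} | [disjoint s & vset t] &&
                             (vset t :|: s \in simplices X)].
Proof. by rewrite inE setU0 vset_simplex -setI_eq0 set0I eqxx. Qed.

Fact link_subproofS j (t : osimplex X j) (s s' : {set V}) :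
  s' \subset s ->
  s \in [set s : {set V} | [disjoint s & vset t] &&
                             (vset t :|: s \in simplices X)] ->
  s' \in [set s : {set V} | [disjoint s & vset t] &&
                             (vset t :|: s \in simplices X)].
Proof.
move=> s's; rewrite !inE => /andP[dst stX]; apply/andP; split.
  exact: disjointWl s's dst.
by apply: scomplexS stX; apply: setUS.
Qed.

Definition link j (t : osimplex X j) : scomplex V :=
  SComplex (link_subproof0 t) (@link_subproofS j t).

Definition link_weight (R : realType) (m : {set V} -> R) j (t : osimplex X j) :
    {set V} -> R :=
  fun s => m (vset t :|: s).

End OrderedSimplices.

Section Operators.
Variables (R : realType) (U W : vectType R).
Implicit Types (pU : U -> U -> R) (pW : W -> W -> R).

(* Existence is [adjointP] below. *)
Definition adjoint pU pW (f : 'Hom(U, W)) : 'Hom(W, U) :=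
  xget 0 [set g : 'Hom(W, U) | forall u w, pW (f u) w = pU u (g w)]%classic.

Definition ipnorm pU (u : U) : R := Num.sqrt (pU u u).

(* The set is nonempty, and bounded above because U is finite dimensional, as
   soon as pU is positive definite, so the [sup] is not a default value. *)
Definition opnorm pU (f : 'End(U)) : R :=
  sup [set ipnorm pU (f u) | u in [set u | ipnorm pU u <= 1]]%classic.

Definition spectrum (f : 'End(U)) : set R := [set x | passmx.leigenvalue f x]%classic.

Lemma adjointP pU pW (f : 'Hom(U, W)) :
  (forall v, scalar (pU^~ v)) -> (forall u, scalar (pU u)) ->
  (forall u, pU u u = 0 -> u = 0) ->
  (forall v, scalar (pW^~ v)) -> (forall u, scalar (pW u)) ->
  forall u w, pW (f u) w = pU u (adjoint pU pW f w).
Proof.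
move=> linUl linUr defU linWl linWr.
pose cU v : 'Hom(U, R^o) := linfun (pU^~ v : U -> R^o).
have cUE v u : cU v u = pU u v.
  pose isl := GRing.isLinear.Build R U R^o _ (pU^~ v) (linUl v).
  pose h : {linear U -> R^o} := HB.pack (pU^~ v : U -> R^o) isl.
  exact: (lfunE h u).
have lin_cU : linear cU.
  by move=> a v w; apply/lfunP => u; rewrite !lfun_simp !cUE linUr.
pose islc := GRing.isLinear.Build R U 'Hom(U, R^o) _ cU lin_cU.
pose hc : {linear U -> 'Hom(U, R^o)} := HB.pack cU islc.
pose T : 'Hom(U, 'Hom(U, R^o)) := linfun hc.
have TE v u : T v u = pU u v by rewrite lfunE /= cUE.
have kerT : lker T == 0%VS.
  apply/lker0P => v w eq_vw; apply/eqP; rewrite -subr_eq0; apply/eqP.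
  have T0 : T (v - w) = 0 by apply/eqP; rewrite linearB subr_eq0; apply/eqP.
  by apply: defU; rewrite -TE T0 lfun_simp.
have imT : limg T = fullv.
  apply/eqP; rewrite eqEdim subvf limg_dim_eq ?(eqP kerT) ?capv0 //.
  by rewrite !dimvf /dim /= muln1.
pose cW w : 'Hom(U, R^o) := linfun (fun u => pW (f u) w : R^o).
have cWE w u : cW w u = pW (f u) w.
  have li : scalar (fun u => pW (f u) w : R^o).
    by move=> a x y /=; rewrite linearP linWl.
  pose isl := GRing.isLinear.Build R U R^o _ (fun u => pW (f u) w : R^o) li.
  pose h : {linear U -> R^o} := HB.pack (fun u => pW (f u) w : R^o) isl.
  exact: (lfunE h u).
have lin_cW : linear cW.
  by move=> a v w; apply/lfunP => u; rewrite !lfun_simp !cWE linWr.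
pose islW := GRing.isLinear.Build R W 'Hom(U, R^o) _ cW lin_cW.
pose hW : {linear W -> 'Hom(U, R^o)} := HB.pack cW islW.
pose g : 'Hom(W, U) := (T^-1 \o linfun hW)%VF.
have gP u w : pW (f u) w = pU u (g w).
  by rewrite -TE /g comp_lfunE limg_lfunVK ?imT ?memvf // lfunE /= cWE.
exact: (@xgetPex _ 0 [set g : 'Hom(W, U) | forall u w, pW (f u) w = pU u (g w)]%classic
        (ex_intro _ g gP)).
Qed.

End Operators.

Section Cochains.
Variables (R : realType) (V : finType) (X : scomplex V).

Definition antisym_defect j (phi : {ffun osimplex X j -> R^o}) :
    {ffun 'S_j * osimplex X j -> R^o} :=
  [ffun p => phi (permute p.1 p.2) - (-1) ^+ p.1 * phi p.2].

Fact antisym_defect_is_linear j : linear (@antisym_defect j).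
Proof.
move=> a f g; apply/ffunP => p; rewrite !ffunE /=.
by rewrite mulrDr scalerBr /= opprD addrACA -[in X in _ - X]scalerAr.
Qed.

HB.instance Definition _ j := GRing.isLinear.Build R _ _ _ (@antisym_defect j)
  (@antisym_defect_is_linear j).

(* The subspace of antisymmetric functions, and C^(j - 1)(X, R) as a vector
   space in its own right. *)
Definition antisym_space j : {vspace {ffun osimplex X j -> R^o}} :=
  lker (linfun (@antisym_defect j)).

Lemma antisym_spaceP j (phi : {ffun osimplex X j -> R^o}) :
  reflect (forall s t, phi (permute s t) = (-1) ^+ s * phi t)
          (phi \in antisym_space j).
Proof.
rewrite memv_ker lfunE /=; apply: (iffP eqP) => [/ffunP e s t | e].
  by have := e (s, t); rewrite !ffunE /= => /eqP; rewrite subr_eq0 => /eqP.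
by apply/ffunP => -[s t]; rewrite !ffunE /= e subrr.
Qed.

Definition cochain j : vectType R := subvs_of (antisym_space j).

Definition cip (m : {set V} -> R) j (phi psi : cochain j) : R :=
  \sum_(t : osimplex X j) m (vset t) / (j`!)%:R * vsval phi t * vsval psi t.

Definition coboundary_fun j (phi : {ffun osimplex X j -> R^o}) :
    {ffun osimplex X j.+1 -> R^o} :=
  [ffun t => \sum_(i < j.+1) (-1) ^+ i * phi (face i t)].

Fact coboundary_fun_is_linear j : linear (@coboundary_fun j).
Proof.
move=> a f g; apply/ffunP => t; rewrite !ffunE /= scaler_sumr -big_split /=.
by apply: eq_bigr => i _; rewrite !ffunE mulrDr scalerAr.
Qed.

HB.instance Definition _ j := GRing.isLinear.Build R _ _ _ (@coboundary_fun j)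
  (@coboundary_fun_is_linear j).

Lemma coboundary_fun_antisym j phi :
  phi \in antisym_space j -> coboundary_fun phi \in antisym_space j.+1.
Proof.
move/antisym_spaceP => phiA; apply/antisym_spaceP => s t; rewrite !ffunE.
rewrite big_distrr /= [RHS](reindex_inj (@perm_inj _ s)) /=.
apply: eq_bigr => i _.
have [s' def_s] : exists s' : 'S_j, s = lift_perm i (s i) s'.
  pose r := (s * lift_perm (s i) i 1)%g.
  have ri : r i = i by rewrite permM lift_perm_id.
  pose h (k : 'I_j) := odflt k (unlift i (r (lift i k))).
  have hE k : lift i (h k) = r (lift i k).
    rewrite /h; case: unliftP => [k' -> //|/= e].
    by have := neq_lift i k; rewrite -(inj_eq (@perm_inj _ r)) ri e eqxx.
  have h_inj : injective h.
    move=> a b e; apply: (@lift_inj _ i); apply: (@perm_inj _ r).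
    by rewrite -!hE e.
  exists (perm h_inj); have -> : s = (r * lift_perm i (s i) 1)%g.
    by rewrite /r -mulgA lift_permM mulg1 lift_perm1 mulg1.
  rewrite permM ri lift_perm_id.
  have -> : r = lift_perm i i (perm h_inj).
    apply/permP => k; case: (unliftP i k) => [k'|] ->.
      by rewrite lift_perm_lift -hE [perm h_inj _]permE.
    by rewrite lift_perm_id ri.
  by rewrite lift_permM mulg1.
have -> : face i (permute s t) = permute s' (face (s i) t).
  apply: val_inj; apply: eq_from_tnth => k; rewrite /= !tnth_mktuple.
  by rewrite {1}def_s lift_perm_lift.
have odd_s : s = odd i (+) odd (s i) (+) s' :> bool.
  by rewrite {1}def_s odd_lift_perm.
rewrite phiA !mulrA -(signr_odd _ i) -(signr_odd _ (s i)) -!signr_addb odd_s.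
by rewrite addbAC addbK addbC.
Qed.

(* d_(j - 1); by [coboundaryE] the projection [vsproj] only repackages. *)
Definition coboundary j : 'Hom(cochain j, cochain j.+1) :=
  linfun (vsproj (antisym_space j.+1) \o @coboundary_fun j \o
          @vsval _ _ (antisym_space j)).

Lemma coboundaryE j (phi : cochain j) (t : osimplex X j.+1) :
  vsval (coboundary j phi) t = \sum_(i < j.+1) (-1) ^+ i * vsval phi (face i t).
Proof.
rewrite /coboundary lfunE /= vsprojK ?ffunE //.
exact/coboundary_fun_antisym/subvsP.
Qed.

Variable m : {set V} -> R.

Definition codiff j : 'Hom(cochain j.+1, cochain j) :=
  adjoint (cip m (j := j)) (cip m (j := j.+1)) (coboundary j).

Lemma codiffP j (phi : cochain j) (psi : cochain j.+1) :
  (forall s : {set V}, s \in simplices X -> 0 < m s) ->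
  cip m (coboundary j phi) psi = cip m phi (codiff j psi).
Proof.
move=> m_gt0.
have linr i (u : cochain i) : scalar (cip m u).
  move=> a v w; rewrite /cip big_distrr -big_split /=; apply: eq_bigr => t _.
  by rewrite !ffunE mulrDr; congr (_ + _); rewrite -[_ *: _]/(_ * _) mulrCA.
have sym i (u v : cochain i) : cip m u v = cip m v u.
  by apply: eq_bigr => t _; rewrite mulrAC.
have linl i (v : cochain i) : scalar (fun u => cip m u v).
  by move=> a u w; rewrite !(sym _ _ v) linr.
apply: adjointP => // u; move/eqP; rewrite psumr_eq0 => [|t _]; last first.
  rewrite -mulrA mulr_ge0 ?sqr_ge0 // divr_ge0 ?ler0n ?ltW //.
  exact/m_gt0/vset_simplex.
move/allP => u0; apply: val_inj; apply/ffunP => t; rewrite !ffunE.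
have := u0 t (mem_index_enum _); rewrite -mulrA mulf_eq0 => /orP[|].
  rewrite mulf_eq0 invr_eq0 pnatr_eq0 eqn0Ngt fact_gt0 orbF.
  by rewrite gt_eqF ?m_gt0 ?vset_simplex.
by rewrite mulf_eq0 orbb => /eqP.
Qed.

(* Delta_k^+ and Delta_k^- for k >= 0, the degree k being the usual one. *)
Definition lap_up (k : nat) : 'End(cochain k.+1) :=
  (codiff k.+1 \o coboundary k.+1)%VF.

Definition lap_down (k : nat) : 'End(cochain k.+1) :=
  (coboundary k \o codiff k)%VF.

End Cochains.

Definition cochain_opnorm (R : realType) (V : finType) (X : scomplex V)
    (m : {set V} -> R) (j : nat) (A : 'End(cochain R X j)) : R :=
  opnorm (@cip R V X m j) A.

Definition link_fun (R : realType) (x : R) : R := 2 - 1 / x.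

(* Main.v *)
Require Import Defs.
From mathcomp Require Import classical_sets set_interval reals.
From mathcomp Require Import all_boot all_order all_fingroup all_algebra.
From mathcomp Require Import ring lra zify.

Set Implicit Arguments.
Unset Strict Implicit.
Unset Printing Implicit Defensive.

Import Order.TTheory GRing.Theory Num.Theory.

Local Open Scope ring_scope.

(** Everything is reduced to functions on the vertices of links.  For an ordered
simplex s and a function g on the vertices of its link, three quadratic forms
measure g in C^0(X_s): its squared norm N_s(g), the squared norm P_s(g) of its
projection on the constants, and its energy E_s(g), the squared norm of dg.

A (k+1)-cochain phi on ordered simplices with k+1 vertices restricts to
phi_s(v) = phi(vs) in the link of each ordered simplex s with k vertices, and
counting ordered simplices gives, up to the common factor 1/k! in the sums,
  (k+1) |phi|^2 = sum_s N_s(phi_s),   |delta phi|^2 = sum_s P_s(phi_s),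
  |d phi|^2 = sum_s E_s(phi_s) - k |phi|^2
([norm_localize], [codiff_localize], [coboundary_localize]).  So the quadratic
form of the operator to be bounded is a sum over s of E_s + c P_s - c N_s.  If
a (N_s - P_s) <= E_s <= b (N_s - P_s) with c the midpoint of a and b
([local_gap]), each term is at most (b - a)/2 N_s in absolute value, and the
sum is at most (k+1)(b - a)/2 |phi|^2.  The operator is self-adjoint, hence its
norm obeys the same bound ([opnorm_le_quadratic]).

In a connected link the inequality [local_gap] says that the nonzero spectrum
of the Laplacian of degree 0 lies in [a, b] ([spectrum_local_gap]).  It is given
for the links of the simplices with n-1 vertices and propagates to smaller
simplices, that is to larger links, by [spectral_descent]: let g be an
eigenfunction on X with eigenvalue x <> 0.  Averaging the restrictions of g over
the links of the vertices v recovers the norm and the energy of g, while the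
mean of g over the neighbours of v is (1 - x) g(v), so that the sum of the P_v
is (1 - x)^2 |g|^2.  The gaps of the links then give
a (1 - (1 - x)^2) <= x <= b (1 - (1 - x)^2), which after division by x is
2 - 1/a <= x <= 2 - 1/b. *)

(** * Symmetric forms and self-adjoint operators *)

Record symmetric_form (R : realType) (U : vectType R) (q : U -> U -> R) : Prop :=
  SymmetricForm {
    form_linear : forall v, scalar (q^~ v);
    form_sym : forall u v, q u v = q v u }.

Section SymmetricForms.
Variables (R : realType) (U : vectType R) (q : U -> U -> R).
Hypothesis q_form : symmetric_form q.

Lemma symformDl u v w : q (u + v) w = q u w + q v w.
Proof. by rewrite -[u]scale1r (form_linear q_form) mul1r scale1r. Qed.

Lemma symform0l w : q 0 w = 0.
Proof. by apply: (addrI (q 0 w)); rewrite -symformDl !addr0. Qed.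

Lemma symformZl a u w : q (a *: u) w = a * q u w.
Proof. by rewrite -[a *: u]addr0 (form_linear q_form) symform0l addr0. Qed.

Lemma symformNl u w : q (- u) w = - q u w.
Proof. by rewrite -scaleN1r symformZl mulN1r. Qed.

Lemma symformDr u v w : q w (u + v) = q w u + q w v.
Proof. by rewrite form_sym // symformDl !(form_sym q_form w). Qed.

Lemma symformZr a u w : q w (a *: u) = a * q w u.
Proof. by rewrite form_sym // symformZl (form_sym q_form w). Qed.

Lemma symformNr u w : q w (- u) = - q w u.
Proof. by rewrite -scaleN1r symformZr mulN1r. Qed.

Lemma symform_suml (I : finType) (F : I -> U) w :
  q (\sum_i F i) w = \sum_i q (F i) w.
Proof.
by apply: (big_morph (q^~ w)) => [u v|]; [apply: symformDl | apply: symform0l].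
Qed.

Lemma form_comp (f : 'End(U)) :
  (forall u v, q (f u) v = q u (f v)) -> symmetric_form (fun u v => q (f u) v).
Proof.
move=> f_adj; split=> [v a u w|u v]; last by rewrite f_adj form_sym.
by rewrite linearP form_linear.
Qed.

Lemma form_cauchy_schwarz u v :
  (forall x, 0 <= q x x) -> q u v ^+ 2 <= q u u * q v v.
Proof.
move=> q_ge0.
have key a b : 0 <= a ^+ 2 * q u u + 2 * a * b * q u v + b ^+ 2 * q v v.
  have := q_ge0 (a *: u + b *: v).
  rewrite !(symformDl, symformDr, symformZl, symformZr) (form_sym q_form v u).
  by congr (0 <= _); ring.
have := q_ge0 v; rewrite le_eqVlt => /predU1P[qv0|qv_gt0].
  (* Here q is affine along v, and at this multiple of v it takes the value -1. *)
  have := key 1 (- (q u u + 1) / (2 * q u v)).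
  have [-> _|nz_q] := eqVneq (q u v) 0; first by rewrite -qv0 expr0n mulr0.
  rewrite -qv0 !mulr0 addr0 => le0.
  suff: (0 : R) <= -1 by rewrite ler0N1.
  move: le0; congr (0 <= _).
  by field.
(* q v v times the component of u orthogonal to v. *)
have := key (q v v) (- q u v).
rewrite [X in 0 <= X](_ : _ = q v v * (q u u * q v v - q u v ^+ 2)); last by ring.
by rewrite pmulr_rge0 // subr_ge0.
Qed.

End SymmetricForms.

Record inner_product (R : realType) (U : vectType R) (ip : U -> U -> R) : Prop :=
  InnerProduct {
    inner_form :> symmetric_form ip;
    inner_gt0 : forall u, u != 0 -> 0 < ip u u }.

Section SelfAdjoint.
Variables (R : realType) (U : vectType R) (ip : U -> U -> R).
Hypothesis ipP : inner_product ip.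

Lemma inner_ge0 u : 0 <= ip u u.
Proof.
have [->|/(inner_gt0 ipP)/ltW//] := eqVneq u 0.
by rewrite (symform0l ipP).
Qed.

Lemma inner_eq0 u : ip u u = 0 -> u = 0.
Proof. by move/eqP; apply: contraTeq => /(inner_gt0 ipP)/lt0r_neq0. Qed.

Lemma inner_inj u v : (forall w, ip u w = ip v w) -> u = v.
Proof.
move=> e; apply/eqP; rewrite -subr_eq0; apply/eqP/inner_eq0.
by rewrite (symformDl ipP) (symformNl ipP) e subrr.
Qed.

(** The Riesz representative of a coordinate is the adjoint of the coordinate
functional evaluated at 1. *)
Lemma coord_riesz i :
  exists r, forall u, coord (vbasis (@fullv R U)) i u = ip u r.
Proof.
pose c : 'Hom(U, R^o) := linfun (coord (vbasis (@fullv R U)) i : U -> R^o).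
pose pR (x y : R^o) : R := x * y.
exists (adjoint ip pR c 1) => u.
have <- : pR (c u) 1 = ip u (adjoint ip pR c 1).
  apply: adjointP => [v|v a x y|v|v a x y|v a x y].
  - exact: (form_linear ipP).
  - by rewrite (symformDr ipP) (symformZr ipP).
  - exact: inner_eq0.
  - by rewrite /pR mulrDl -[a *: x]/(a * x) mulrA.
  - by rewrite /pR mulrDr -[a *: x]/(a * x) mulrCA.
by rewrite /pR mulr1 lfunE.
Qed.

(** In a basis with Riesz representatives r_i of the coordinates, <f u, u> is the
sum of the products <u, r_i> <f e_i, u>, each controlled by Cauchy-Schwarz.
This is the only form of compactness that the spectral argument below uses. *)
Lemma quadratic_bounded (f : 'End(U)) :
  exists2 C, 0 < C & forall u, `|ip (f u) u| <= C * ip u u.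
Proof.
pose e := vbasis (@fullv R U).
have [r rP] := fin_all_exists coord_riesz.
have cs x y : ip x y ^+ 2 <= ip x x * ip y y.
  by apply: form_cauchy_schwarz inner_ge0; exact: ipP.
pose C := 1 + \sum_i (ip (r i) (r i) + ip (f e`_i) (f e`_i)) / 2.
exists C => [|u].
  rewrite ltr_pwDl ?ltr01 // sumr_ge0 // => i _.
  by rewrite divr_ge0 ?addr_ge0 ?inner_ge0 ?ler0n.
have fuE : ip (f u) u = \sum_i ip u (r i) * ip (f e`_i) u.
  rewrite {1}(coord_vbasis (memvf u)) linear_sum /= (symform_suml ipP).
  by apply: eq_bigr => i _; rewrite linearZ /= (symformZl ipP) rP.
rewrite fuE (le_trans (ler_norm_sum _ _ _)) // mulrDl mul1r.
rewrite -[leLHS]add0r lerD ?inner_ge0 // mulr_suml ler_sum // => i _.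
have := cs u (r i); have := cs (f e`_i) u.
set x := ip u (r i); set y := ip (f _) u => le_y le_x.
have p := sqr_ge0 (x + y); have s := sqr_ge0 (x - y).
by rewrite ler_norml; apply/andP; split; nra.
Qed.

(** The supremum M of the Rayleigh quotients of f is an eigenvalue.  Otherwise
g = M - f is injective, hence invertible, and the Cauchy-Schwarz inequality for
the nonnegative form <g x, y>, at x = g^-1 u and y = u, yields
<u, u>^2 <= <u, g^-1 u> <g u, u> <= K <u, u> <g u, u>, so that every Rayleigh
quotient is at most M - 1/K. *)
Lemma selfadjoint_le (f : 'End(U)) b :
  (forall u v, ip (f u) v = ip u (f v)) ->
  (forall a u, u != 0 -> f u = a *: u -> a <= b) ->
  forall u, ip (f u) u <= b * ip u u.
Proof.
move=> f_adj f_eig u.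
have [->|nz_u] := eqVneq u 0; first by rewrite linear0 (symform0l ipP) mulr0.
pose E := [set ip (f x) x / ip x x | x in [set x | x != 0]]%classic.
have E_u : E (ip (f u) u / ip u u) by exists u.
have [C C_gt0 fC] := quadratic_bounded f.
have ubE : has_ubound E.
  exists C => _ [x /= nz_x <-]; rewrite ler_pdivrMr ?(inner_gt0 ipP) //.
  exact: le_trans (ler_norm _) (fC x).
rewrite -ler_pdivrMr ?(inner_gt0 ipP) //.
apply: le_trans (ub_le_sup ubE E_u) _.
set M := sup E; rewrite leNgt; apply/negP => lt_bM.
pose g : 'End(U) := M *: \1%VF - f.
have gE x : g x = M *: x - f x by rewrite !lfun_simp.
have g_adj x y : ip (g x) y = ip x (g y).
  by rewrite !gE !(symformDl ipP, symformDr ipP, symformNl ipP, symformNr ipP,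
                   symformZl ipP, symformZr ipP) f_adj.
have g_ge0 x : 0 <= ip (g x) x.
  have [->|nz_x] := eqVneq x 0; first by rewrite linear0 (symform0l ipP).
  rewrite gE (symformDl ipP) (symformZl ipP) (symformNl ipP) subr_ge0.
  rewrite -ler_pdivrMr ?(inner_gt0 ipP) //.
  by apply: ub_le_sup => //; exists x.
have ker_g : lker g == 0%VS.
  apply/lker0P => x y eq_xy; apply/eqP; rewrite -subr_eq0.
  apply: contraTT lt_bM => nz; rewrite -leNgt.
  apply: (f_eig _ (x - y)) => //; apply/eqP; rewrite eq_sym -subr_eq0 -gE.
  by rewrite linearB subr_eq0; apply/eqP.
have [K K_gt0 hK] := quadratic_bounded (g^-1)%VF.
suff : M <= M - K^-1 by rewrite lerBrDr gerDl leNgt invr_gt0 K_gt0.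
apply: ge_sup; first by exists (ip (f u) u / ip u u).
move=> _ [x /= nz_x <-]; have x_gt0 := inner_gt0 ipP nz_x.
rewrite ler_pdivrMr // mulrBl lerBrDr -lerBrDl.
have <- : ip (g x) x = M * ip x x - ip (f x) x.
  by rewrite gE (symformDl ipP) (symformZl ipP) (symformNl ipP).
rewrite ler_pdivrMl //.
have := form_cauchy_schwarz (form_comp ipP g_adj) (g^-1%VF x) x g_ge0.
rewrite lker0_lfunVK // => le_x.
rewrite -(ler_pM2l x_gt0) -expr2 (le_trans le_x) //.
rewrite mulrCA mulrA ler_wpM2r ?g_ge0 //.
by rewrite (form_sym ipP) (le_trans (ler_norm _)) // mulrC hK.
Qed.

Lemma selfadjoint_ge (f : 'End(U)) b :
  (forall u v, ip (f u) v = ip u (f v)) ->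
  (forall a u, u != 0 -> f u = a *: u -> b <= a) ->
  forall u, b * ip u u <= ip (f u) u.
Proof.
move=> f_adj f_eig u.
have fN x : (- f : 'End(U)) x = - f x by rewrite !lfun_simp.
have := @selfadjoint_le (- f) (- b) _ _ u.
rewrite fN (symformNl ipP) mulNr lerN2; apply=> [x y|a x nz_x].
  by rewrite !fN (symformNl ipP) (symformNr ipP) f_adj.
rewrite fN => /(congr1 -%R); rewrite opprK -scaleNr => /f_eig.
by rewrite lerNr => ->.
Qed.

(** Polarization turns the bound on <f u, u> into
2 <f x, y> <= B (|x|^2 + |y|^2); the choice x = B u, y = f u balances both
sides. *)
Lemma opnorm_le_quadratic (f : 'End(U)) B : 0 <= B ->
  (forall u v, ip (f u) v = ip u (f v)) ->
  (forall u, `|ip (f u) u| <= B * ip u u) -> opnorm ip f <= B.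
Proof.
move=> B_ge0 f_adj f_le; apply: ge_sup.
  exists (ipnorm ip (f 0)), 0 => //=.
  by rewrite /ipnorm (symform0l ipP) sqrtr0 ler01.
move=> _ [u /= u_le1 <-].
have polar x y : 2 * ip (f x) y <= B * (ip x x + ip y y).
  have /ler_normlP[_ p] := f_le (x + y); have /ler_normlP[s _] := f_le (x - y).
  move: p s; rewrite linearB linearD /=.
  rewrite !(symformDl ipP, symformDr ipP, symformNl ipP, symformNr ipP).
  rewrite (form_sym ipP y x) (_ : ip (f y) x = ip (f x) y).
    by move=> p s; lra.
  by rewrite f_adj (form_sym ipP).
have u1 : ip u u <= 1.
  rewrite -(@ler_sqrt _ _ 1) ?ler01 // sqrtr1; exact: u_le1.
have fu : ip (f u) (f u) <= B ^+ 2.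
  have := B_ge0; rewrite le_eqVlt => /predU1P[B0|B_gt0].
    have := polar u (f u); rewrite -B0 mul0r pmulr_rle0 // => /le_trans->//.
    by rewrite expr0n.
  have := polar (B *: u) (f u).
  rewrite !(linearZ, symformZl ipP, symformZr ipP) /= => le.
  have: ip (f u) (f u) <= B * (B * ip u u) by nra.
  by move=> /le_trans-> //; nra.
by rewrite /ipnorm -(ger0_norm B_ge0) -sqrtr_sqr ler_wsqrtr.
Qed.

End SelfAdjoint.

(** * Sums over tuples and alternating functions *)

Section TupleSums.
Variables (R : comPzRingType) (V : finType).
Implicit Types (F G H : seq V -> R) (s : seq V).

Lemma sum_tuple0 F : \sum_(t : 0.-tuple V) F t = F [::].
Proof.
rewrite (bigD1 [tuple]) //= big1 ?addr0 // => t.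
by case/eqP; exact: tuple0.
Qed.

Lemma sum_tupleS k F :
  \sum_(t : k.+1.-tuple V) F t = \sum_v \sum_(s : k.-tuple V) F (v :: s).
Proof.
rewrite pair_bigA /=.
rewrite (reindex (fun p : V * k.-tuple V => [tuple of p.1 :: p.2])) //=.
exists (fun t : k.+1.-tuple V => (thead t, [tuple of behead t])) => [[v s] _|t _].
  by rewrite theadE; congr pair; apply: val_inj.
by rewrite -tuple_eta.
Qed.

Definition insert_at i (v : V) s := take i s ++ v :: drop i s.
Definition delete_at i s := take i s ++ drop i.+1 s.

(** A (k+1)-tuple is determined by its entry at position i and the tuple of the
others, whatever i is. *)
Lemma sum_tuple_insert k i F : (i <= k)%N ->
  \sum_(t : k.+1.-tuple V) F t =
  \sum_v \sum_(s : k.-tuple V) F (insert_at i v s).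
Proof.
elim: i k F => [|i IHi] k F; first by under [in RHS]eq_bigr do
  under eq_bigr do rewrite /insert_at take0 drop0; rewrite sum_tupleS.
case: k => // k le_ik; rewrite sum_tupleS.
under eq_bigr do rewrite (IHi k (fun s => F (_ :: s))) //.
rewrite exchange_big /=; apply: eq_bigr => v _.
by rewrite (sum_tupleS _ (fun s => F (insert_at i.+1 v s))).
Qed.

Lemma delete_insert i v s : (i <= size s)%N ->
  delete_at i (insert_at i v s) = s.
Proof.
move=> le_is; rewrite /delete_at /insert_at take_size_cat ?size_takel //.
rewrite drop_cat size_takel // ltnNge leqnSn subSnn /= drop0.
exact: cat_take_drop.
Qed.

Definition alternating G :=
  forall s1 u v s2, G (s1 ++ u :: v :: s2) = - G (s1 ++ v :: u :: s2).

Lemma alternating_insert G i v s : alternating G -> (i <= size s)%N ->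
  G (insert_at i v s) = (-1) ^+ i * G (v :: s).
Proof.
move=> G_alt; elim: i => [|i IHi] lt_is.
  by rewrite /insert_at take0 drop0 mul1r.
rewrite exprS -mulrA -IHi 1?ltnW // /insert_at (take_nth v lt_is).
by rewrite cat_rcons G_alt (drop_nth v lt_is) mulN1r.
Qed.

(** Moving the i-th entry of t to the front costs the sign (-1)^i, which cancels
the sign of the i-th term: the k+1 terms of the alternating sum contribute
equally.  This is the combinatorial core of the formulas for d and delta. *)
Lemma sum_alternating k G H : alternating G ->
  \sum_(t : k.+1.-tuple V) G t * (\sum_(i < k.+1) (-1) ^+ i * H (delete_at i t)) =
  k.+1%:R * \sum_v \sum_(s : k.-tuple V) G (v :: s) * H s.
Proof.
move=> G_alt; under eq_bigr do rewrite mulr_sumr.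
rewrite exchange_big /= -[in k.+1%:R](card_ord k.+1) mulr_natl -sumr_const.
apply: eq_bigr => i _; have le_ik : (i <= k)%N by rewrite -ltnS.
rewrite (sum_tuple_insert (fun t => G t * ((-1) ^+ i * H (delete_at i t))) le_ik).
apply: eq_bigr => v _; apply: eq_bigr => s _.
have le_is : (i <= size s)%N by rewrite size_tuple.
rewrite delete_insert // alternating_insert // mulrACA mulrA -expr2 sqrr_sign.
by rewrite mul1r.
Qed.

End TupleSums.

(** * Weights of ordered simplices *)

Section OrderedWeights.
Variables (R : realType) (V : finType) (X : scomplex V) (m : {set V} -> R).
Implicit Types s : seq V.

Definition is_osimplex s := uniq s && ([set x in s] \in simplices X).

(** Vanishing outside the complex replaces membership conditions in sums by
factors of the summands. *)
Definition sweight s : R := if is_osimplex s then m [set x in s] else 0.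

Lemma is_osimplex_perm s1 s2 : perm_eq s1 s2 -> is_osimplex s1 = is_osimplex s2.
Proof.
move=> e; rewrite /is_osimplex (perm_uniq e).
suff -> : [set x in s1] = [set x in s2] by [].
by apply/setP => x; rewrite !inE (perm_mem e).
Qed.

Lemma is_osimplex_behead v s : is_osimplex (v :: s) -> is_osimplex s.
Proof.
case/andP => /= /andP[_ us] vsX; rewrite /is_osimplex us /=.
by apply: scomplexS vsX; apply/subsetP => x; rewrite !inE orbC => ->.
Qed.

Lemma sweight_perm s1 s2 : perm_eq s1 s2 -> sweight s1 = sweight s2.
Proof.
move=> e; rewrite /sweight (is_osimplex_perm e); case: ifP => // _.
by congr m; apply/setP => x; rewrite !inE (perm_mem e).
Qed.

Lemma sweight_swap u v s : sweight (u :: v :: s) = sweight (v :: u :: s).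
Proof. exact/sweight_perm/permEl/(perm_catCA [:: u] [:: v]). Qed.

Lemma sweight_rot u v w s :
  sweight (u :: v :: w :: s) = sweight (w :: u :: v :: s).
Proof. exact/sweight_perm/permEl/(perm_catCA [:: u; v] [:: w]). Qed.

Hypothesis m_gt0 : forall s : {set V}, s \in simplices X -> 0 < m s.

Lemma sweight_gt0 s : (0 < sweight s) = is_osimplex s.
Proof.
rewrite /sweight; case: ifP; last by rewrite ltxx.
by case/andP => _ /m_gt0.
Qed.

Lemma sweight_ge0 s : 0 <= sweight s.
Proof.
rewrite /sweight; case: ifP => // /andP[_ /m_gt0]; exact: ltW.
Qed.

Lemma sweight_eq0 s : (sweight s == 0) = ~~ is_osimplex s.
Proof. by rewrite -sweight_gt0 lt0r sweight_ge0 andbT negbK. Qed.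

Lemma sweight_behead0 v s : sweight s = 0 -> sweight (v :: s) = 0.
Proof.
move/eqP; rewrite sweight_eq0 => ns; apply/eqP; rewrite sweight_eq0.
by apply: contra ns; apply: is_osimplex_behead.
Qed.

End OrderedWeights.

(** Ordered simplices v :: s extending s correspond one to one to the simplices
with one more vertex that contain s, which turns the balance condition into a
sum over vertices.  When s is not a simplex both sides vanish. *)
Lemma sweight_balanced (R : realType) (V : finType) (n : nat) (X : scomplex V)
    (m : {set V} -> R) (s : seq V) :
  balanced_weight n X m -> (size s <= n)%N ->
  \sum_v sweight X m (v :: s) = sweight X m s.
Proof.
case=> m_gt0 m_bal le_sn; have [s_simp|] := boolP (is_osimplex X s); last first.
  rewrite -(sweight_eq0 m_gt0) => /eqP s0; rewrite s0 big1 // => v _.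
  exact: sweight_behead0.
have [us sX] := andP s_simp.
have card_s : #|[set x in s]| = size s by rewrite cardsE; apply/card_uniqP.
rewrite [RHS]/sweight s_simp -m_bal ?card_s //.
under eq_bigr do rewrite /sweight /is_osimplex /=.
rewrite -big_mkcond /=.
pose h v := [set x in v :: s].
have hE v : h v = v |: [set x in s] by apply/setP => x; rewrite !inE.
have h_inj : {in [pred v | v \notin s] &, injective h}.
  move=> u v /= us' vs' /setP/(_ u); rewrite !inE eqxx /=.
  by rewrite inE in us'; rewrite (negPf us') orbF => /esym/eqP.
rewrite -(@big_imset _ _ _ _ _ h [pred v | (v \notin s) && uniq s && (h v \in X)] m) /=.
  apply: eq_bigl => S; apply/imsetP/idP => [[v]|].
    rewrite !inE -andbA => /and3P[vs _ hv] ->.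
    by rewrite hv hE cardsU1 card_s inE vs eqxx subsetUr.
  case/and3P => SX /eqP cS sS.
  have: #|S :\: [set x in s]| == 1%N.
    by rewrite cardsD (setIidPr sS) cS card_s subSnn.
  case/cards1P => v defv; have : v \in S :\: [set x in s] by rewrite defv set11.
  rewrite !inE => /andP[vs vS].
  have eS : S = h v.
    by rewrite hE -(setID S [set x in s]) (setIidPr sS) defv setUC.
  by exists v; rewrite // inE vs us -eS.
move=> u v; rewrite !inE -!andbA => /and3P[uS _ _] /and3P[vS _ _].
by apply: h_inj; rewrite inE.
Qed.

(** * Cochains as functions on sequences *)

Section Extension.
Variables (R : realType) (V : finType) (X : scomplex V).
Implicit Types s : seq V.

Definition oval j (t : osimplex X j) : seq V := val (val t).

Lemma size_oval j (t : osimplex X j) : size (oval t) = j.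
Proof. exact: size_tuple. Qed.

Lemma oval_simplex j (t : osimplex X j) : is_osimplex X (oval t).
Proof. exact: valP t. Qed.

Lemma ovalP j s : size s = j -> is_osimplex X s ->
  exists t : osimplex X j, oval t = s.
Proof.
move=> size_s sX; move/eqP in size_s.
by exists (Sub (Tuple size_s) sX).
Qed.

(** Extending a cochain by zero to all sequences lets sums range over all tuples
and all vertices; the weight vanishes wherever the default value is used. *)
Definition ext j (phi : cochain R X j) (s : seq V) : R :=
  oapp (fun t : j.-tuple V => oapp (vsval phi) 0 (insub t)) 0 (insub s).

Lemma ext_oval j (phi : cochain R X j) t : ext phi (oval t) = vsval phi t.
Proof. by rewrite /ext valK /= valK. Qed.

Lemma ext_nonsimplex j (phi : cochain R X j) s : ~~ is_osimplex X s -> ext phi s = 0.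
Proof.
move=> sX; rewrite /ext; case: insubP => //= t _ ts.
by case: insubP => //= u uX; rewrite /is_osimplex -ts in sX; case/negP: sX.
Qed.

Lemma ext_wrong_size j (phi : cochain R X j) s : size s != j -> ext phi s = 0.
Proof. by rewrite /ext; case: insubP => //= t /eqP ->; rewrite eqxx. Qed.

Lemma ext_inj j (phi psi : cochain R X j) :
  (forall t : osimplex X j, ext phi (oval t) = ext psi (oval t)) -> phi = psi.
Proof.
move=> e; apply: val_inj; apply/ffunP => t; have := e t.
by rewrite !ext_oval.
Qed.

Lemma nth_permute j (s : 'S_j) (t : osimplex X j) x0 (i : 'I_j) :
  nth x0 (oval (permute s t)) i = nth x0 (oval t) (s i).
Proof. by rewrite /oval -!tnth_nth tnth_mktuple. Qed.

(** Both sides vanish unless the sequence is an ordered simplex of the right size,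
and then the exchange of neighbours is a transposition of its positions. *)
Lemma ext_alternating j (phi : cochain R X j) : alternating (ext phi).
Proof.
move=> s1 u v s2; set s := _ ++ _; set s' := s1 ++ _.
have pss' : perm_eq s' s.
  by rewrite perm_cat2l; exact/permEl/(perm_catCA [:: v] [:: u]).
have [sX|] := boolP (is_osimplex X s); last first.
  by move=> nsX; rewrite !ext_nonsimplex ?oppr0 // (is_osimplex_perm X pss').
have [size_s|] := eqVneq (size s) j; last first.
  by move=> nsize; rewrite !ext_wrong_size ?oppr0 // (perm_size pss').
have [t ts] := ovalP size_s sX.
have lt1 : (size s1 < j)%N by rewrite -size_s /s size_cat /=; lia.
have lt2 : ((size s1).+1 < j)%N by rewrite -size_s /s size_cat /=; lia.
pose p := tperm (Ordinal lt1) (Ordinal lt2).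
have -> : s' = oval (permute p t).
  apply: (@eq_from_nth _ u); first by rewrite size_oval (perm_size pss').
  move=> i; rewrite (perm_size pss') size_s => lt_ij.
  rewrite (nth_permute _ _ _ (Ordinal lt_ij)) ts /s /s' !nth_cat.
  rewrite /p; case: tpermP => [/(congr1 val)/= ->|/(congr1 val)/= ->|] /=.
  - by rewrite ltnn subnn ltnNge leqnSn subSnn.
  - by rewrite ltnNge leqnSn subSnn ltnn subnn.
  move=> /eqP; rewrite -val_eqE /= => ni1 /eqP; rewrite -val_eqE /= => ni2.
  case: ltnP => // le_i.
  have -> : (i - size s1 = (i - (size s1).+2).+2)%N by lia.
  by [].
rewrite -ts !ext_oval; have /antisym_spaceP -> := subvsP phi.
have ne12 : Ordinal lt1 != Ordinal lt2 by rewrite -val_eqE /= neq_ltn leqnn.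
by rewrite odd_tperm ne12 mulN1r opprK.
Qed.

Lemma cochain_of j (g : seq V -> R) :
  (forall (p : 'S_j) (t : osimplex X j),
    g (oval (permute p t)) = (-1) ^+ p * g (oval t)) ->
  exists phi : cochain R X j,
    forall t : osimplex X j, ext phi (oval t) = g (oval t).
Proof.
move=> g_alt.
exists (vsproj (antisym_space R X j) [ffun t : osimplex X j => g (oval t)]) => t.
rewrite ext_oval vsprojK ?ffunE //; apply/antisym_spaceP => p u.
by rewrite !ffunE.
Qed.

Lemma oval_face j (i : 'I_j.+1) (t : osimplex X j.+1) :
  oval (face i t) = delete_at i (oval t).
Proof.
have x0 := thead (val t).
have sz : size (delete_at i (oval t)) = j.
  by rewrite size_cat size_drop size_take size_oval ltn_ord subSS subnKC // -ltnS.
apply: (@eq_from_nth _ x0) => [|k]; first by rewrite size_oval sz.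
rewrite size_oval => lt_k; pose k' := Ordinal lt_k.
rewrite /oval -[k]/(val k') -tnth_nth tnth_mktuple (tnth_nth x0) /= /bump.
rewrite nth_cat size_takel; last by rewrite size_tuple ltnW.
case: ltnP => [lt_ki|le_ik]; first by rewrite nth_take.
by rewrite nth_drop add1n; congr nth; lia.
Qed.

Lemma sum_osimplex j (F : seq V -> R) :
  \sum_(t : osimplex X j) F (oval t) =
  \sum_(t : j.-tuple V | is_osimplex X t) F t.
Proof.
symmetry; apply: (big_sub [pred t : j.-tuple V | is_osimplex X t]).
Qed.

End Extension.

(** * Localization of norms, coboundaries and codifferentials *)

Section LocalForms.
Variables (R : realType) (V : finType) (w : seq V -> R).
Implicit Types (s : seq V) (g : V -> R).

(** The weights w (v :: s) and w (u :: v :: s) are those of the vertices and of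
the edges of the link of s, so [local_norm], [local_mean] and [local_energy]
are the squared norms of g, of its projection on the constants and of its
coboundary in C^0(X_s); the factor 1/2 in the energy is there because every
edge occurs in two orders. *)
Definition local_norm s g := \sum_v w (v :: s) * g v ^+ 2.

Definition local_mean s g := (\sum_v w (v :: s) * g v) ^+ 2 / w s.

Definition local_energy s g :=
  2^-1 * \sum_u \sum_v w (u :: v :: s) * (g u - g v) ^+ 2.

(** Expanding the square, each of the two square terms sums to the norm because edge weights
at a vertex add up to the weight of that vertex. *)
Lemma local_energyE s g :
  (forall u v, w (u :: v :: s) = w (v :: u :: s)) ->
  (forall v, \sum_u w (u :: v :: s) = w (v :: s)) ->
  local_energy s g =
    local_norm s g - \sum_u \sum_v w (u :: v :: s) * (g u * g v).
Proof.
move=> w_sym w_bal; apply: (mulfI (x := 2)); first by rewrite pnatr_eq0.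
rewrite mulrA mulfV ?pnatr_eq0 // mul1r.
have -> : 2 * (local_norm s g - \sum_u \sum_v w (u :: v :: s) * (g u * g v)) =
   (\sum_u \sum_v w (u :: v :: s) * g v ^+ 2) +
   (\sum_u \sum_v w (u :: v :: s) * g u ^+ 2) -
   2 * \sum_u \sum_v w (u :: v :: s) * (g u * g v).
  rewrite mulrBr; congr (_ - _); rewrite mulr_natl mulr2n; congr (_ + _).
    rewrite exchange_big; apply: eq_bigr => v _ /=.
    by rewrite -w_bal mulr_suml.
  apply: eq_bigr => u _ /=; rewrite -w_bal mulr_suml.
  by apply: eq_bigr => v _; rewrite w_sym.
rewrite -big_split mulr_sumr /= -sumrB; apply: eq_bigr => u _.
rewrite -big_split mulr_sumr /= -sumrB; apply: eq_bigr => v _.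
ring.
Qed.

End LocalForms.

Section CochainForms.
Variables (R : realType) (V : finType) (X : scomplex V) (m : {set V} -> R).
Hypothesis m_gt0 : forall s : {set V}, s \in simplices X -> 0 < m s.
Let w := sweight X m.

Lemma cipE j (phi psi : cochain R X j) :
  cip m phi psi = (j`!)%:R^-1 * \sum_(t : j.-tuple V) w t * (ext phi t * ext psi t).
Proof.
rewrite mulr_sumr (bigID (fun t : j.-tuple V => is_osimplex X t)) /= addrC.
rewrite big1 ?add0r => [|t /negPf tX]; last by rewrite /w /sweight tX mul0r mulr0.
rewrite -(sum_osimplex X j (fun t => _ * (w t * (ext phi t * ext psi t)))).
apply: eq_bigr => t _; rewrite !ext_oval /w /sweight oval_simplex.
by rewrite -/(vset t); ring.
Qed.

Lemma cip_inner_product j : inner_product (@cip R V X m j).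
Proof.
split; first split => [v a x y|u v].
- rewrite /cip mulr_sumr -big_split /=; apply: eq_bigr => t _.
  by rewrite !ffunE -[a *: _]/(a * _); ring.
- by apply: eq_bigr => t _; rewrite mulrAC.
move=> u nz_u; have term_ge0 (t : osimplex X j) :
    0 <= m (vset t) / (j`!)%:R * vsval u t * vsval u t.
  rewrite -mulrA mulr_ge0 ?sqr_ge0 // divr_ge0 ?ler0n // ltW //.
  exact/m_gt0/vset_simplex.
rewrite lt0r sumr_ge0 // andbT psumr_neq0 //; apply/hasP.
suff [t nz_t] : exists t, vsval u t != 0.
  exists t; rewrite ?mem_index_enum //= lt0r term_ge0 andbT.
  rewrite !mulf_neq0 ?invr_eq0 ?pnatr_eq0 -?lt0n ?fact_gt0 //.
  by rewrite gt_eqF ?m_gt0 ?vset_simplex.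
apply/existsP; apply: contraNT nz_u; rewrite negb_exists => /forallP u0.
by apply/eqP/val_inj/ffunP => t; have := u0 t; rewrite negbK !ffunE => /eqP.
Qed.

Lemma ext_coboundary j (phi : cochain R X j) s : size s = j.+1 ->
  w s * ext (coboundary R X j phi) s =
  w s * \sum_(i < j.+1) (-1) ^+ i * ext phi (delete_at i s).
Proof.
move=> size_s; have [sX|/negPf sX] := boolP (is_osimplex X s); last first.
  by rewrite /w /sweight sX !mul0r.
have [t <-] := ovalP size_s sX; rewrite ext_oval coboundaryE; congr (_ * _).
by apply: eq_bigr => i _; rewrite -oval_face ext_oval.
Qed.

Lemma weighted_alternating j (phi : cochain R X j) :
  alternating (fun s => w s * ext phi s).
Proof.
move=> s1 u v s2; rewrite ext_alternating mulrN; congr (- (_ * _)).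
apply: sweight_perm; rewrite perm_cat2l.
exact/permEl/(perm_catCA [:: u] [:: v]).
Qed.

Lemma cip_coboundary j (phi : cochain R X j) (psi : cochain R X j.+1) :
  cip m (coboundary R X j phi) psi = (j`!)%:R^-1 *
    \sum_v \sum_(s : j.-tuple V) w (v :: s) * ext psi (v :: s) * ext phi s.
Proof.
rewrite cipE; under eq_bigr do rewrite mulrA ext_coboundary ?size_tuple //
  -mulrA [X in _ * X]mulrC mulrA.
rewrite (sum_alternating j (ext phi) (weighted_alternating psi)) mulrA.
congr (_ * _); rewrite factS natrM invfM mulrAC mulVf ?mul1r //.
by rewrite pnatr_eq0.
Qed.

(** A permutation of the last entries extends by fixing the first one. *)
Lemma cons_permute j (p : 'S_j) (t : osimplex X j) (u : osimplex X j.+1) v :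
  oval u = v :: oval t ->
  v :: oval (permute p t) = oval (permute (lift_perm ord0 ord0 p) u).
Proof.
move=> uE; apply: (@eq_from_nth _ v) => [|i]; first by rewrite /= !size_oval.
rewrite /= size_oval => lt_i; rewrite (nth_permute _ _ _ (Ordinal lt_i)) uE.
case: i lt_i => [|i] lt_i /=.
  have -> : Ordinal lt_i = ord0 by apply: val_inj.
  by rewrite lift_perm_id.
have lt_i' : (i < j)%N by [].
have -> : Ordinal lt_i = lift ord0 (Ordinal lt_i') by apply: val_inj.
by rewrite lift_perm_lift /= (nth_permute _ _ _ (Ordinal lt_i')).
Qed.

(** The averaged function S / w is an antisymmetric cochain, and [cip_coboundary]
says that it has the defining property of the adjoint. *)
Lemma ext_codiff j (psi : cochain R X j.+1) s : size s = j ->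
  w s * ext (codiff X m j psi) s = \sum_v w (v :: s) * ext psi (v :: s).
Proof.
pose S (r : seq V) : R := \sum_v w (v :: r) * ext psi (v :: r).
have w_permute i (p : 'S_i) (t : osimplex X i) :
    perm_eq (oval (permute p t)) (oval t).
  by apply/tuple_permP; exists p.
have S_alt (p : 'S_j) (t : osimplex X j) :
    S (oval (permute p t)) / w (oval (permute p t)) =
    (-1) ^+ p * (S (oval t) / w (oval t)).
  rewrite /w (sweight_perm X m (w_permute _ p t)) -/w mulrA; congr (_ / _).
  rewrite mulr_sumr; apply: eq_bigr => v _.
  have -> : w (v :: oval (permute p t)) = w (v :: oval t).
    by apply: sweight_perm; rewrite perm_cons.
  have [vtX|/negPf vtX] := boolP (is_osimplex X (v :: oval t)); last first.
    by rewrite /w /sweight vtX !mul0r mulr0.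
  have [|u uE] := @ovalP _ _ j.+1 _ _ vtX; first by rewrite /= size_oval.
  rewrite (cons_permute p uE) -uE !ext_oval; have /antisym_spaceP -> := subvsP psi.
  by rewrite odd_lift_perm /= mulrCA.
have [theta thetaE] := @cochain_of R V X j (fun r => S r / w r) S_alt.
have S0 r : ~~ is_osimplex X r -> S r = 0.
  rewrite -(sweight_eq0 m_gt0) => /eqP r0; rewrite /S big1 // => v _.
  by rewrite /w (sweight_behead0 m_gt0) ?mul0r.
have wtheta r : size r = j -> w r * ext theta r = S r.
  move=> size_r; have [rX|nrX] := boolP (is_osimplex X r); last first.
    by rewrite ext_nonsimplex ?S0 ?mulr0.
  have [t tr] := ovalP size_r rX; rewrite -tr thetaE mulrC divfK //.
  by rewrite tr (sweight_eq0 m_gt0) rX.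
suff -> : codiff X m j psi = theta by apply: wtheta.
apply: (inner_inj (cip_inner_product j)) => phi.
rewrite !(form_sym (cip_inner_product j) _ phi) -codiffP //.
rewrite cip_coboundary cipE exchange_big; congr (_ * _).
apply: eq_bigr => r _ /=; rewrite mulrCA wtheta ?size_tuple // mulrC.
by rewrite mulr_suml.
Qed.

Lemma norm_localize j (phi : cochain R X j.+1) :
  j.+1%:R * cip m phi phi =
  (j`!)%:R^-1 * \sum_(s : j.-tuple V) local_norm w s (fun v => ext phi (v :: s)).
Proof.
rewrite cipE (sum_tupleS _ (fun s => w s * (ext phi s * ext phi s))).
rewrite exchange_big mulrA; congr (_ * _).
by rewrite factS natrM invfM mulrA mulfV ?mul1r // pnatr_eq0.
Qed.

(** By [ext_codiff], w s * (delta phi)(s)^2 is the square of the weighted sum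
of phi over the link of s, divided by w s. *)
Lemma codiff_localize j (phi : cochain R X j.+1) :
  cip m (codiff X m j phi) (codiff X m j phi) =
  (j`!)%:R^-1 * \sum_(s : j.-tuple V) local_mean w s (fun v => ext phi (v :: s)).
Proof.
rewrite cipE; congr (_ * _); apply: eq_bigr => s _.
rewrite /local_mean -ext_codiff ?size_tuple //.
have [-> |nz_w] := eqVneq (w s) 0; first by rewrite !mul0r expr0n mul0r.
by field.
Qed.

(** Apply [sum_alternating] twice to |d phi|^2 = <d phi, d phi>: once to remove
one of the coboundaries, then to the sum left in the other.  This gives
|d phi|^2 = |phi|^2 - C / j!, where C collects the products
phi (v :: s) * phi (u :: s).  The energies satisfy
sum_s E_s = sum_s N_s - C by [local_energyE], and comparing both leaves
j copies of |phi|^2. *)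
Lemma coboundary_localize j (phi : cochain R X j.+1) :
  (forall s, (size s <= j.+1)%N -> \sum_v w (v :: s) = w s) ->
  cip m (coboundary R X j.+1 phi) (coboundary R X j.+1 phi) =
  (j`!)%:R^-1 *
    (\sum_(s : j.-tuple V) local_energy w s (fun v => ext phi (v :: s)))
  - j%:R * cip m phi phi.
Proof.
move=> w_bal.
pose cross := \sum_v \sum_u \sum_(s : j.-tuple V)
  w (v :: u :: s) * (ext phi (v :: s) * ext phi (u :: s)).
have -> : \sum_(s : j.-tuple V) local_energy w s (fun v => ext phi (v :: s)) =
    (\sum_(s : j.-tuple V) local_norm w s (fun v => ext phi (v :: s))) - cross.
  have -> : cross = \sum_(s : j.-tuple V) \sum_u \sum_v
      w (u :: v :: s) * (ext phi (u :: s) * ext phi (v :: s)).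
    by rewrite exchange_big; apply: eq_bigr => u _; rewrite exchange_big.
  rewrite -sumrB; apply: eq_bigr => s _.
  apply: local_energyE => [u v|v]; first exact: sweight_swap.
  by rewrite w_bal //= size_tuple.
rewrite mulrBr -norm_localize mulrSr mulrDl mul1r addrAC [_ + cip _ _ _]addrC addrK.
rewrite cip_coboundary cipE.
have -> : \sum_v \sum_(s : j.+1.-tuple V)
    w (v :: s) * ext (coboundary R X j.+1 phi) (v :: s) * ext phi s =
  (\sum_(s : j.+1.-tuple V) w s * (ext phi s * ext phi s)) - j.+1%:R * cross.
  rewrite [in RHS]/cross [in RHS]mulr_sumr.
  have -> : \sum_(s : j.+1.-tuple V) w s * (ext phi s * ext phi s) =
     \sum_v \sum_(s : j.+1.-tuple V) w (v :: s) * (ext phi s * ext phi s).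
    rewrite exchange_big; apply: eq_bigr => s _ /=.
    by rewrite -mulr_suml w_bal ?size_tuple.
  rewrite -sumrB; apply: eq_bigr => v _.
  have wv_alt : alternating (fun s => w (v :: s) * ext phi s).
    move=> s1 a b s2; rewrite ext_alternating mulrN; congr (- (_ * _)).
    apply: sweight_perm; rewrite perm_cons perm_cat2l.
    exact/permEl/(perm_catCA [:: a] [:: b]).
  have := sum_alternating j (fun s => ext phi (v :: s)) wv_alt.
  under [X in _ = _ * X]eq_bigr do
    under eq_bigr do rewrite -mulrA [ext _ _ * ext _ _]mulrC.
  move=> <-; rewrite -sumrB; apply: eq_bigr => s _.
  rewrite ext_coboundary; last by rewrite /= size_tuple.
  have tailE : \sum_(i < j.+1) (-1) ^+ lift ord0 i *
        ext phi (delete_at (lift ord0 i) (v :: s)) =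
      - \sum_(i < j.+1) (-1) ^+ i * ext phi (v :: delete_at i s).
    rewrite -sumrN; apply: eq_bigr => i _.
    by rewrite /= /bump add1n exprS mulN1r mulNr.
  by rewrite big_ord_recl tailE /delete_at /= drop0; ring.
rewrite mulrBr mulrA; congr (_ - _ * _).
by rewrite factS natrM invfM mulrAC mulVf ?mul1r // pnatr_eq0.
Qed.

End CochainForms.

(** * The Laplacian of degree zero *)

(** On functions orthogonal to the constants this bounds the Laplacian of the
link of s between a and b; subtracting the mean removes the orthogonality
condition. *)
Definition local_gap (R : realType) (V : finType) (w : seq V -> R) s a b :=
  forall g : V -> R,
    a * (local_norm w s g - local_mean w s g) <= local_energy w s g
      <= b * (local_norm w s g - local_mean w s g).

Section DegreeZero.
Variables (R : realType) (V : finType) (X : scomplex V) (m : {set V} -> R).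
Hypothesis m_gt0 : forall s : {set V}, s \in simplices X -> 0 < m s.
Let w := sweight X m.
Hypothesis w_bal : forall s, (size s <= 1)%N -> \sum_v w (v :: s) = w s.
Let d := coboundary R X 1.
Let delta := codiff X m 0.
Let up := lap_up X m 0.
Let down := lap_down X m 0.
Let ipX j := cip_inner_product m_gt0 j.

Definition vertex_fun (phi : cochain R X 1) (v : V) : R := ext phi [:: v].

Lemma vertex_fun_surj (g : V -> R) :
  exists phi, forall v, is_osimplex X [:: v] -> vertex_fun phi v = g v.
Proof.
have [|phi phiE] := @cochain_of R V X 1 (fun s => if s is v :: _ then g v else 0).
  move=> p t; rewrite permS1 odd_perm1 mul1r; case E: (oval t) => [|v s].
    by have := size_oval t; rewrite E.
  have := nth_permute 1 t v ord0; rewrite E perm1 /=.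
  by case: (oval _) (size_oval (permute 1 t)) => //= u s' _ ->.
exists phi => v vX; have [t tv] := @ovalP _ X 1 [:: v] erefl vX.
by rewrite /vertex_fun -tv phiE tv.
Qed.

Lemma vertex_norm phi : cip m phi phi = local_norm w [::] (vertex_fun phi).
Proof.
have := norm_localize m phi; rewrite fact0 invr1 !mul1r => ->.
exact: (sum_tuple0 (fun s => local_norm _ s (fun v => ext phi (v :: s)))).
Qed.

Lemma vertex_mean phi :
  cip m (delta phi) (delta phi) = local_mean w [::] (vertex_fun phi).
Proof.
by rewrite (codiff_localize m_gt0) fact0 invr1 mul1r (sum_tuple0 (fun s =>
  local_mean _ s (fun v => ext phi (v :: s)))).
Qed.

Lemma vertex_energy phi :
  cip m (d phi) (d phi) = local_energy w [::] (vertex_fun phi).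
Proof.
by rewrite (coboundary_localize phi w_bal) fact0 invr1 mul1r mul0r subr0
  (sum_tuple0 (fun s => local_energy _ s (fun v => ext phi (v :: s)))).
Qed.

Lemma ext_coboundary1 phi u v : is_osimplex X [:: u; v] ->
  ext (d phi) [:: u; v] = vertex_fun phi v - vertex_fun phi u.
Proof.
move=> uvX; apply: (@mulfI _ (w [:: u; v])).
  by rewrite (sweight_eq0 m_gt0) uvX.
rewrite (ext_coboundary _ phi) //; congr (_ * _).
by rewrite !big_ord_recl big_ord0 addr0 expr0 mul1r expr1 mulN1r.
Qed.

Lemma ext_coboundary0 (theta : cochain R X 0) v : is_osimplex X [:: v] ->
  vertex_fun (coboundary R X 0 theta) v = ext theta [::].
Proof.
move=> vX; apply: (@mulfI _ (w [:: v])); first by rewrite (sweight_eq0 m_gt0) vX.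
rewrite /vertex_fun (ext_coboundary _ theta) //; congr (_ * _).
by rewrite big_ord_recl big_ord0 addr0 expr0 mul1r.
Qed.

(** [down phi] is constant, as the image of a function on the empty simplex. *)
Lemma d_down phi : d (down phi) = 0.
Proof.
apply: ext_inj => t; have tX := oval_simplex t.
have [u [v tuv]] : exists u v, oval t = [:: u; v].
  by case: (oval t) (size_oval t) => [|u [|v []]] // _; exists u, v.
rewrite tuv in tX *; rewrite ext_coboundary1 // /down /lap_down lfunE /=.
have vX := is_osimplex_behead tX.
have uX : is_osimplex X [:: u].
  apply: (@is_osimplex_behead _ _ v); rewrite -(@is_osimplex_perm _ _ [:: u; v]) //.
  exact/permEl/(perm_catCA [:: u] [:: v] [::]).
rewrite !ext_coboundary0 // subrr; have [t' <-] := @ovalP _ X 2 [:: u; v] erefl tX.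
by rewrite ext_oval ffunE.
Qed.

Lemma cip_up phi psi : cip m (up phi) psi = cip m (d phi) (d psi).
Proof.
by rewrite (form_sym (ipX _)) /up /lap_up lfunE /= -codiffP // (form_sym (ipX _)).
Qed.

Lemma cip_down phi psi : cip m (down phi) psi = cip m (delta phi) (delta psi).
Proof. by rewrite /down /lap_down lfunE /= codiffP. Qed.

Lemma down_up phi : down (up phi) = 0.
Proof.
apply: (inner_inj (ipX 1)) => psi.
rewrite cip_down (form_sym (ipX _)) -cip_down (form_sym (ipX _)) cip_up d_down.
by rewrite (form_sym (ipX _)) !(symform0l (ipX _)).
Qed.

Hypothesis X_conn : connected_complex X.

(** Connectedness enters here: a function with zero coboundary is constant along
edges, hence constant, and [down] averages it to itself. *)
Lemma down_closed phi : d phi = 0 -> down phi = phi.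
Proof.
move=> dphi0.
have edge u v : [set u; v] \in simplices X -> vertex_fun phi u = vertex_fun phi v.
  have [-> //|ne_uv] := eqVneq u v => uvX.
  have uv_simp : is_osimplex X [:: u; v].
    rewrite /is_osimplex /= inE ne_uv /=.
    by rewrite (_ : [set x in _] = [set u; v]) //; apply/setP => x; rewrite !inE.
  have := ext_coboundary1 phi uv_simp; rewrite dphi0.
  have [t <-] := @ovalP _ X 2 [:: u; v] erefl uv_simp; rewrite ext_oval ffunE.
  by move/esym/eqP; rewrite subr_eq0 => /eqP.
have const u v : is_osimplex X [:: u] -> is_osimplex X [:: v] ->
    vertex_fun phi u = vertex_fun phi v.
  have set1E (x : V) : [set y in [:: x]] = [set x].
    by apply/setP => y; rewrite !inE.
  rewrite /is_osimplex /= !set1E.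
  move=> uX vX; have /connectP[p] := X_conn uX vX.
  elim: p u {uX} => [|x p IHp] u /=; first by move=> _ ->.
  by case/andP => /edge -> /IHp.
have w0 : w [::] != 0.
  rewrite (sweight_eq0 m_gt0) negbK /is_osimplex /=.
  suff -> : [set x in [::]] = set0 :> {set V} by apply: scomplex0.
  by apply/setP => x; rewrite !inE.
apply: ext_inj => t; have tX := oval_simplex t.
have [u tu] : exists u, oval t = [:: u].
  by case: (oval t) (size_oval t) => [|u []] // _; exists u.
rewrite tu in tX *; rewrite /down /lap_down lfunE /=.
rewrite -/(vertex_fun _ u) ext_coboundary0 //.
apply: (mulfI w0); rewrite ext_codiff // -w_bal // mulr_suml.
apply: eq_bigr => v _; have [vX|nvX] := boolP (is_osimplex X [:: v]).
  by rewrite -/(vertex_fun phi v) (const v u).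
by rewrite -(sweight_eq0 m_gt0) in nvX; rewrite /w (eqP nvX) !mul0r.
Qed.

(** [down] is the orthogonal projection on the constants, where [up] vanishes, so
adding c * down only moves the eigenvalue 0 of [up] to c. *)
Lemma lap0_eigenvalue c a phi : phi != 0 ->
  up phi + c *: down phi = a *: phi -> a = c \/ a != 0 /\ spectrum up a.
Proof.
move=> nz_phi eig.
have [down0|nz_down] := eqVneq (down phi) 0; last first.
  left; have := congr1 down eig; rewrite linearD !linearZ /= down_up add0r.
  rewrite (down_closed (d_down phi)) => /eqP; rewrite -subr_eq0 -scalerBl.
  by rewrite scaler_eq0 (negPf nz_down) orbF subr_eq0 => /eqP.
right; rewrite down0 scaler0 addr0 in eig; split.
  apply: contra nz_phi => /eqP a0; rewrite a0 scale0r in eig.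
  suff dphi0 : d phi = 0 by rewrite -(down_closed dphi0) down0.
  apply: (inner_eq0 (ipX 2)).
  by rewrite -cip_up eig (symform0l (ipX _)).
rewrite /spectrum /passmx.leigenvalue /=; apply: contra nz_phi => /eqP ker0.
have : phi \in passmx.leigenspace up a.
  rewrite /passmx.leigenspace memv_ker add_lfunE opp_lfunE scale_lfunE id_lfunE.
  by rewrite eig subrr.
by rewrite ker0 memv0.
Qed.

Lemma local_forms_eq s g g' : (forall v, is_osimplex X (v :: s) -> g v = g' v) ->
  [/\ local_norm w s g = local_norm w s g',
      local_mean w s g = local_mean w s g' &
      local_energy w s g = local_energy w s g'].
Proof.
move=> eg; have wg v (x y : R) :
    (is_osimplex X (v :: s) -> x = y) -> w (v :: s) * x = w (v :: s) * y.
  have [_ ->//|nX _] := boolP (is_osimplex X (v :: s)).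
  by rewrite -(sweight_eq0 m_gt0) in nX; rewrite /w (eqP nX) !mul0r.
split.
- by apply: eq_bigr => v _; apply: wg => /eg->.
- by congr (_ ^+ 2 / _); apply: eq_bigr => v _; apply: wg => /eg->.
congr (_ * _); apply: eq_bigr => u _; apply: eq_bigr => v _.
have [uvX|nX] := boolP (is_osimplex X (u :: v :: s)); last first.
  by rewrite -(sweight_eq0 m_gt0) in nX; rewrite /w (eqP nX) !mul0r.
rewrite (eg v (is_osimplex_behead uvX)) (eg u) //.
apply: (@is_osimplex_behead _ _ v); rewrite -(@is_osimplex_perm _ _ [:: u, v & s]) //.
exact/permEl/(perm_catCA [:: u] [:: v]).
Qed.

(** By [lap0_eigenvalue] all eigenvalues of [up + c * down] lie in [a, b] as soon
as c does.  The lower bound is the case c = a and the upper one the case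
c = b. *)
Lemma spectrum_local_gap a b : a <= b ->
  (spectrum up `\ 0 `<=` `[a, b])%classic -> local_gap w [::] a b.
Proof.
move=> le_ab spec g.
have [phi phiE] := vertex_fun_surj g.
have [<- <- <-] := local_forms_eq phiE.
rewrite -vertex_norm -vertex_mean -vertex_energy.
have T_E c psi : (up + c *: down) psi = up psi + c *: down psi.
  by rewrite add_lfunE scale_lfunE.
have T_adj c x y : cip m ((up + c *: down) x) y = cip m x ((up + c *: down) y).
  rewrite !T_E !(symformDl (ipX _), symformDr (ipX _), symformZl (ipX _), symformZr (ipX _)).
  rewrite cip_up cip_down !(form_sym (ipX _) x) cip_up cip_down.
  by rewrite (form_sym (ipX _) (d x)) (form_sym (ipX _) (delta x)).
have T_q c : cip m ((up + c *: down) phi) phi =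
    cip m (d phi) (d phi) + c * cip m (delta phi) (delta phi).
  by rewrite T_E (symformDl (ipX _)) (symformZl (ipX _)) cip_up cip_down.
have T_eig c x psi : a <= c <= b -> psi != 0 ->
    (up + c *: down) psi = x *: psi -> a <= x <= b.
  move=> c_ab nz_psi; rewrite T_E.
  case/(lap0_eigenvalue nz_psi) => [-> //|[/eqP nz_x x_spec]].
  by have := spec x (conj x_spec nz_x); rewrite /= in_itv.
apply/andP; split; rewrite mulrBr.
  rewrite lerBlDr -T_q; apply: selfadjoint_ge => // x psi nz_psi.
  by move=> /(T_eig a)-/(_ _ nz_psi)/andP[] //; rewrite lexx.
rewrite lerBrDr -T_q; apply: selfadjoint_le => // x psi nz_psi.
by move=> /(T_eig b)-/(_ _ nz_psi)/andP[] //; rewrite lexx andbT.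
Qed.

End DegreeZero.

(** * Spectral descent from the links of vertices *)

Section Descent.
Variables (R : realType) (V : finType) (X : scomplex V) (m : {set V} -> R).
Hypothesis m_gt0 : forall s : {set V}, s \in simplices X -> 0 < m s.
Let w := sweight X m.
Hypothesis w_bal : forall s, (size s <= 2)%N -> \sum_v w (v :: s) = w s.
Let w_bal1 s : (size s <= 1)%N -> \sum_v w (v :: s) = w s.
Proof. by move=> le1; apply/w_bal/leqW. Qed.

(** The Laplacian of degree 0 is the identity minus the weighted average over
neighbours. *)
Lemma lap0_eigenfun x (phi : cochain R X 1) v : lap_up X m 0 phi = x *: phi ->
  \sum_u w [:: u; v] * vertex_fun phi u = (1 - x) * (w [:: v] * vertex_fun phi v).
Proof.
move=> eig; have : w [:: v] * ext (lap_up X m 0 phi) [:: v] =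
    w [:: v] * (x * vertex_fun phi v).
  have [vX|nvX] := boolP (is_osimplex X [:: v]); last first.
    by rewrite -(sweight_eq0 m_gt0) in nvX; rewrite /w (eqP nvX) !mul0r.
  have [t tv] := @ovalP _ X 1 [:: v] erefl vX.
  by rewrite /vertex_fun -tv eig !ext_oval ffunE.
rewrite /lap_up lfunE /= ext_codiff // mulrBl mul1r mulrCA => <-.
rewrite -[w [:: v]]w_bal1 // mulr_suml -sumrB; apply: eq_bigr => u _.
have [uvX|nX] := boolP (is_osimplex X [:: u; v]); last first.
  by rewrite -(sweight_eq0 m_gt0) in nX; rewrite /w (eqP nX) !mul0r subr0.
by rewrite (ext_coboundary1 m_gt0) // -/w; ring.
Qed.

Lemma sum_local_norm s g : (size s <= 1)%N ->
  \sum_v local_norm w (v :: s) g = local_norm w s g.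
Proof.
move=> le1; rewrite exchange_big; apply: eq_bigr => u _ /=.
rewrite -mulr_suml -[in RHS]w_bal //; congr (_ * _).
by apply: eq_bigr => v _; apply: sweight_swap.
Qed.

Lemma sum_local_energy g :
  \sum_v local_energy w [:: v] g = local_energy w [::] g.
Proof.
rewrite -mulr_sumr exchange_big; congr (_ * _); apply: eq_bigr => u _ /=.
rewrite exchange_big; apply: eq_bigr => v _ /=.
rewrite -mulr_suml -[in RHS]w_bal //; congr (_ * _).
by apply: eq_bigr => z _; apply: sweight_rot.
Qed.

Lemma sum_local_mean_eigen x (phi : cochain R X 1) :
  lap_up X m 0 phi = x *: phi ->
  \sum_v local_mean w [:: v] (vertex_fun phi) =
  (1 - x) ^+ 2 * local_norm w [::] (vertex_fun phi).
Proof.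
move=> eig; rewrite mulr_sumr; apply: eq_bigr => v _.
rewrite /local_mean (lap0_eigenfun v eig).
have [->|nz_w] := eqVneq (w [:: v]) 0; first by rewrite !mul0r !mulr0 expr0n mul0r.
by field.
Qed.

(** Summing the gaps of the links over all vertices, tested on an eigenfunction
with eigenvalue x, bounds x N between a x (2 - x) N and b x (2 - x) N. *)
Lemma spectral_descent (a b : R) : 0 < a -> a <= b ->
  (forall v, local_gap w [:: v] a b) ->
  (spectrum (lap_up X m 0) `\ 0 `<=` `[link_fun a, link_fun b])%classic.
Proof.
move=> a_gt0 le_ab gap x [/= x_spec /eqP nz_x].
pose phi := vpick (passmx.leigenspace (lap_up X m 0) x).
have nz_phi : phi != 0 by rewrite vpick0.
have eig : lap_up X m 0 phi = x *: phi.
  have : phi \in passmx.leigenspace (lap_up X m 0) x by apply: memv_pick.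
  rewrite /passmx.leigenspace memv_ker add_lfunE opp_lfunE scale_lfunE id_lfunE.
  by rewrite subr_eq0 => /eqP.
have ipX := cip_inner_product m_gt0.
pose g := vertex_fun phi; pose N := local_norm w [::] g.
have N_gt0 : 0 < N by rewrite /N -(vertex_norm m); apply: inner_gt0.
have E_x : local_energy w [::] g = x * N.
  rewrite -(vertex_energy w_bal1) -(cip_up m_gt0) eig.
  by rewrite (symformZl (ipX _)) (vertex_norm m).
have x_gt0 : 0 < x.
  rewrite lt0r nz_x -(pmulr_lge0 x N_gt0) -E_x -(vertex_energy w_bal1).
  exact/inner_ge0/ipX.
have lo : a * (N - (1 - x) ^+ 2 * N) <= x * N.
  rewrite -E_x /N -sum_local_energy -sum_local_mean_eigen // -(@sum_local_norm [::] g isT).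
  by rewrite -sumrB mulr_sumr ler_sum // => v _; case/andP: (gap v g).
have hi : x * N <= b * (N - (1 - x) ^+ 2 * N).
  rewrite -E_x /N -sum_local_energy -sum_local_mean_eigen // -(@sum_local_norm [::] g isT).
  by rewrite -sumrB mulr_sumr ler_sum // => v _; case/andP: (gap v g).
have fac c : c * (N - (1 - x) ^+ 2 * N) = (c * (2 - x)) * (x * N) by ring.
have xN_gt0 : 0 < x * N by rewrite mulr_gt0.
move: lo hi; rewrite !fac ger_pMl // ler_pMl // => lo hi.
rewrite in_itv /= /link_fun; apply/andP; split.
  by rewrite lerBlDr -lerBlDl ler_pdivlMr // mulrC.
rewrite lerBrDr -lerBrDl ler_pdivrMr 1?mulrC //.
exact: lt_le_trans le_ab.
Qed.

End Descent.

(** * Links and iterated descent *)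

Section Links.
Variables (R : realType) (V : finType) (X : scomplex V) (m : {set V} -> R).
Variables (j : nat) (t : osimplex X j).

Lemma is_osimplex_link s : is_osimplex (link t) s = is_osimplex X (s ++ oval t).
Proof.
rewrite /is_osimplex inE cat_uniq -!andbA; congr (_ && _).
have /andP[-> _] := oval_simplex t; rewrite andTb; congr (_ && _).
  apply/pred0P/hasPn => h x.
    by move=> xt; apply/negP => xs; have := h x; rewrite /= !inE xs [_ \in _]xt.
  by rewrite /= !inE; apply/negP => /andP[xs /h]; rewrite xs.
suff -> : vset t :|: [set x in s] = [set x in s ++ oval t] by [].
by apply/setP => x; rewrite !inE mem_cat orbC.
Qed.

Lemma sweight_link s :
  sweight (link t) (link_weight m t) s = sweight X m (s ++ oval t).
Proof.
rewrite /sweight is_osimplex_link; case: ifP => // _; congr m.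
by apply/setP => x; rewrite !inE mem_cat orbC.
Qed.

(** A link of a link is a link: its weights are obtained by concatenation. *)
Lemma local_gap_link s a b :
  local_gap (sweight (link t) (link_weight m t)) s a b <->
  local_gap (sweight X m) (s ++ oval t) a b.
Proof.
have norm_link g : local_norm (sweight (link t) (link_weight m t)) s g =
    local_norm (sweight X m) (s ++ oval t) g.
  by apply: eq_bigr => v _; rewrite sweight_link.
have mean_link g : local_mean (sweight (link t) (link_weight m t)) s g =
    local_mean (sweight X m) (s ++ oval t) g.
  rewrite /local_mean sweight_link; congr (_ ^+ 2 / _).
  by apply: eq_bigr => v _; rewrite sweight_link.
have energy_link g : local_energy (sweight (link t) (link_weight m t)) s g =
    local_energy (sweight X m) (s ++ oval t) g.
  by congr (_ * _); do 2![apply: eq_bigr => ? _]; rewrite sweight_link.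
by split=> gap g; have := gap g; rewrite norm_link mean_link energy_link.
Qed.

Lemma link_weight_gt0 : (forall s : {set V}, s \in simplices X -> 0 < m s) ->
  forall s : {set V}, s \in simplices (link t) -> 0 < link_weight m t s.
Proof. by move=> m_gt0 s; rewrite inE => /andP[_ /m_gt0]. Qed.

End Links.

Lemma local_gap_nonsimplex (R : realType) (V : finType) (X : scomplex V)
    (m : {set V} -> R)
    (s : seq V) a b : (forall s : {set V}, s \in simplices X -> 0 < m s) ->
  ~~ is_osimplex X s -> local_gap (sweight X m) s a b.
Proof.
move=> m_gt0; rewrite -(sweight_eq0 m_gt0) => /eqP w0 g.
have w1 v := sweight_behead0 m_gt0 v w0.
have -> : local_norm (sweight X m) s g = 0.
  by rewrite /local_norm big1 // => v _; rewrite w1 mul0r.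
have -> : local_mean (sweight X m) s g = 0 by rewrite /local_mean w0 invr0 mulr0.
have -> : local_energy (sweight X m) s g = 0.
  rewrite /local_energy big1 ?mulr0 // => u _; rewrite big1 // => v _.
  by rewrite (sweight_behead0 m_gt0) ?mul0r.
by rewrite subr0 !mulr0 lexx.
Qed.

Lemma link_fun_lt (R : realType) k (x : R) :
  k.+1%:R / k.+2%:R < x -> k%:R / k.+1%:R < link_fun x.
Proof.
have k1 : 0 < k.+1%:R :> R by rewrite ltr0Sn.
have k2 : 0 < k.+2%:R :> R by rewrite ltr0Sn.
move=> lt_x; have x_gt0 : 0 < x by apply: lt_trans lt_x; rewrite divr_gt0.
rewrite /link_fun ltr_pdivrMr // mulrBl ltrBrDr -ltrBrDl div1r ltr_pdivrMl //.
move: lt_x; rewrite ltr_pdivrMr // -!natr1; lra.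
Qed.

Lemma link_fun_le (R : realType) (x y : R) :
  0 < x -> x <= y -> link_fun x <= link_fun y.
Proof.
move=> x_gt0 le_xy; rewrite lerD2l lerN2 !div1r lef_pV2 //.
by rewrite posrE (lt_le_trans x_gt0).
Qed.

(** The map 2 - 1/x sends (k+1)/(k+2) to k/(k+1), so that the n-1 first iterates
of a number above (n-1)/n stay positive, where the map is increasing. *)
Lemma iter_link_fun (R : realType) n i (x y : R) : (i < n)%N ->
  (n%:R - 1) / n%:R < x -> x <= y ->
  (n - i).-1%:R / (n - i)%:R < iter i (@link_fun R) x <= iter i (@link_fun R) y.
Proof.
move=> lt_in lt_x le_xy; elim: i lt_in => [|i IHi] lt_in.
  rewrite subn0 /= le_xy andbT; case: n lt_in lt_x => // n _.
  by rewrite -natr1 addrK.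
have /andP[lo hi] := IHi (ltnW lt_in).
have [k nik] : exists k, (n - i = k.+2)%N by exists (n - i).-2; lia.
have -> : (n - i.+1 = k.+1)%N by lia.
rewrite nik /= in lo; rewrite !iterS link_fun_lt //= link_fun_le //.
by apply: lt_trans lo; rewrite divr_gt0 ?ltr0Sn.
Qed.

Section LinkGap.
Variables (R : realType) (V : finType) (n : nat) (X : scomplex V).
Variables (m : {set V} -> R) (lambda kappa : R).
Hypothesis n_gt1 : (1 < n)%N.
Hypothesis m_bal : balanced_weight n X m.
Hypothesis links_conn : forall (j : nat) (tau : osimplex X j), (j < n)%N ->
  connected_complex (link tau).
Hypotheses (lambda_gt : (n%:R - 1) / n%:R < lambda) (le_lk : lambda <= kappa).
Hypothesis top_spec : (\bigcup_(tau : osimplex X n.-1)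
      spectrum (lap_up (link tau) (link_weight m tau) 0) `\ 0
    `<=` `[lambda, kappa])%classic.
Let w := sweight X m.
Let m_gt0 : forall s : {set V}, s \in simplices X -> 0 < m s := proj1 m_bal.

Lemma sweight_link_balanced j (t : osimplex X j) s : (size s + j <= n)%N ->
  \sum_v sweight (link t) (link_weight m t) (v :: s) =
  sweight (link t) (link_weight m t) s.
Proof.
move=> le_n; rewrite sweight_link -(sweight_balanced m_bal).
  by apply: eq_bigr => v _; rewrite sweight_link.
by rewrite size_cat size_oval.
Qed.

(** Induction on i, that is on decreasing size of s: the base case is the
spectral assumption on one-dimensional links, and each step applies
[spectral_descent] inside the link of s, whose vertex links are links of
simplices with one vertex more. *)
Lemma link_gap i s : (i < n)%N -> size s = (n.-1 - i)%N ->
  local_gap w s (iter i (@link_fun R) lambda) (iter i (@link_fun R) kappa).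
Proof.
have link_spec_gap (j : nat) (t : osimplex X j) (a b : R) : (j < n)%N -> a <= b ->
    (spectrum (lap_up (link t) (link_weight m t) 0) `\ 0 `<=` `[a, b])%classic ->
    local_gap w (oval t) a b.
  move=> lt_jn le_ab spec; apply/(@local_gap_link _ _ X m _ t [::]).
  apply: spectrum_local_gap => //; first exact: link_weight_gt0.
    by move=> r r_le1; apply: sweight_link_balanced; lia.
  exact: links_conn.
elim: i s => [|i IHi] s lt_in size_s;
  have [sX|] := boolP (is_osimplex X s); try exact: local_gap_nonsimplex.
  rewrite subn0 in size_s; have [t <-] := ovalP size_s sX.
  apply: link_spec_gap => //; first by lia.
  by move=> x [x_spec nz_x]; apply: top_spec; split => //; exists t.
have [t <-] := ovalP size_s sX.
have /andP[lo le_i] := iter_link_fun (ltnW lt_in) lambda_gt le_lk.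
have /andP[_ le_i1] := iter_link_fun lt_in lambda_gt le_lk.
apply: link_spec_gap => //; first by lia.
apply: spectral_descent => //; first exact: link_weight_gt0.
- by move=> r r_le2; apply: sweight_link_balanced; lia.
- by apply: le_lt_trans lo; rewrite divr_ge0.
move=> v; apply/(@local_gap_link _ _ X m _ t [:: v]); apply: IHi => /=.
  exact: ltnW.
by rewrite size_oval; lia.
Qed.

End LinkGap.

(** * The norm bound *)

(** Since 0 <= P_s, the bounds of [local_gap] give
|E_s - c (N_s - P_s)| <= (b - a)/2 (N_s - P_s) <= (b - a)/2 N_s for the midpoint
c, and the shift by k |phi|^2 in [coboundary_localize] accounts for the term
k / (k+1). *)
Lemma laplacian_quadratic_bound (R : realType) (V : finType) (n k : nat)
    (X : scomplex V) (m : {set V} -> R) (phi : cochain R X k.+1) (a b c : R) :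
  balanced_weight n X m -> (k < n)%N -> c = (a + b) / 2 -> a <= b ->
  (forall s, size s = k -> local_gap (sweight X m) s a b) ->
  `|cip m (coboundary R X k.+1 phi) (coboundary R X k.+1 phi)
    + c * cip m (codiff X m k phi) (codiff X m k phi)
    - k.+1%:R * (c - k%:R / k.+1%:R) * cip m phi phi|
  <= k.+1%:R / 2 * (b - a) * cip m phi phi.
Proof.
move=> m_bal lt_kn cE le_ab gap; have m_gt0 := proj1 m_bal; pose w := sweight X m.
have w_balk s : (size s <= k.+1)%N -> \sum_v w (v :: s) = w s.
  by move=> s_le; apply: sweight_balanced m_bal _; lia.
pose loc s v := ext phi (v :: s).
have -> : k.+1%:R * (c - k%:R / k.+1%:R) = c * k.+1%:R - k%:R.
  by rewrite mulrBr mulrC mulrCA mulfV ?mulr1 ?pnatr_eq0.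
have := norm_localize m phi; rewrite (coboundary_localize phi w_balk).
rewrite (codiff_localize m_gt0).
set A := (k`!)%:R^-1; set E := \sum_s local_energy _ _ _.
set M := \sum_s local_mean _ _ _; set N := \sum_s local_norm _ _ _.
set q := cip m phi phi => qE.
rewrite (_ : _ - _ = A * (E + c * M) - c * (k.+1%:R * q)); last by ring.
rewrite [leRHS](_ : _ = (b - a) / 2 * (k.+1%:R * q)); last by ring.
rewrite qE (_ : _ - _ = A * (E + c * M - c * N)); last by ring.
have A_ge0 : 0 <= A by rewrite invr_ge0 ler0n.
rewrite normrM ger0_norm // [leRHS](_ : _ = A * ((b - a) / 2 * N)); last by ring.
apply: ler_wpM2l => //; rewrite !mulr_sumr -big_split -sumrB /=.
apply: le_trans (ler_norm_sum _ _ _) _; apply: ler_sum => s _.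
have /andP[] := gap s (size_tuple s) (loc s).
rewrite -[fun v => ext _ _]/(loc s).
have : 0 <= local_mean w s (loc s).
  by rewrite divr_ge0 ?sqr_ge0 // sweight_ge0.
set e := local_energy _ _ _; set mu := local_mean _ _ _; set nu := local_norm _ _ _.
by move=> mu_ge0 lo hi; rewrite cE ler_norml; apply/andP; split; nra.
Qed.

Theorem corollary6p3 (R : realType) (V : finType) (n : nat) (X : scomplex V)
    (m : {set V} -> R) (lambda kappa : R) :
  (1 < n)%N ->
  pure_dim n X ->
  balanced_weight n X m ->
  (* links of dimension n - j > 0; j = 0 gives X itself *)
  (forall (j : nat) (tau : osimplex X j), (j < n)%N ->
     connected_complex (link tau)) ->
  (n%:R - 1) / n%:R < lambda -> lambda <= kappa ->
  (\bigcup_(tau : osimplex X n.-1)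
      spectrum (lap_up (link tau) (link_weight m tau) 0) `\ 0
    `<=` `[lambda, kappa])%classic ->
  forall k : nat, (k <= n.-1)%N ->
    let fl := iter (n.-1 - k) (@link_fun R) lambda in
    let fk := iter (n.-1 - k) (@link_fun R) kappa in
    let c := (fl + fk) / 2 in
    cochain_opnorm m
      (lap_up X m k + c *: lap_down X m k
       - (k.+1%:R * (c - k%:R / k.+1%:R)) *: \1%VF)
    <= k.+1%:R / 2 * (fk - fl).
Proof.
move=> n_gt1 _ m_bal links_conn lambda_gt le_lk top_spec k le_kn; cbv zeta.
set fl := iter _ _ lambda; set fk := iter _ _ kappa; set c := (fl + fk) / 2.
have lt_kn : (k < n)%N by lia.
have lt_in : (n.-1 - k < n)%N by lia.
have m_gt0 := proj1 m_bal; have ipX := cip_inner_product m_gt0.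
have /andP[_ le_fl] := iter_link_fun lt_in lambda_gt le_lk.
have opE phi : (lap_up X m k + c *: lap_down X m k
       - (k.+1%:R * (c - k%:R / k.+1%:R)) *: \1%VF)%VF phi =
    lap_up X m k phi + c *: lap_down X m k phi
       - (k.+1%:R * (c - k%:R / k.+1%:R)) *: phi.
  by rewrite !add_lfunE opp_lfunE !scale_lfunE id_lfunE.
have upE phi psi : cip m (lap_up X m k phi) psi =
    cip m (coboundary R X k.+1 phi) (coboundary R X k.+1 psi).
  by rewrite (form_sym (ipX _)) /lap_up lfunE /= -codiffP // (form_sym (ipX _)).
have downE phi psi : cip m (lap_down X m k phi) psi =
    cip m (codiff X m k phi) (codiff X m k psi).
  by rewrite /lap_down lfunE /= codiffP.
apply: (opnorm_le_quadratic (ipX _)) => [|phi psi|phi].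
- by rewrite mulr_ge0 ?divr_ge0 ?ler0n // subr_ge0.
- rewrite (form_sym (ipX _) phi) !opE.
  rewrite !(symformDl (ipX _), symformNl (ipX _), symformZl (ipX _)) !upE !downE.
  rewrite (form_sym (ipX _) (coboundary R X k.+1 psi)).
  by rewrite (form_sym (ipX _) (codiff X m k psi)) (form_sym (ipX _) psi).
rewrite opE !(symformDl (ipX _), symformNl (ipX _), symformZl (ipX _)) upE downE.
apply: (laplacian_quadratic_bound phi m_bal) => // s size_s.
apply: (link_gap n_gt1 m_bal links_conn lambda_gt le_lk top_spec lt_in).
by rewrite size_s; lia.
Qed.
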